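(* A hypergraph $G$ is $\alpha$-acyclic if and only if it does not contain a simple cycle.
   Context: A hypergraph $G=(V,E)$ consists of a finite set $V$ of nodes and a set $E$ of subsets of $V$ of cardinality at least two, called edges. $G$ is $\alpha$-acyclic if $E$ has the running intersection property: there is an ordering $f_1,\dots,f_m$ of the elements of $E$ such that for each $k=2,\dots,m$ there exists $j<k$ with $f_k\cap\bigl(\bigcup_{i<k}f_i\bigr)\subseteq f_j$. A simple cycle of $G$ of length $\ell\ge 3$ is a sequence $C=e_1,e_2,\dots,e_\ell,e_{\ell+1}$ of edges of $G$ with $e_{\ell+1}=e_1$ such that, setting $s_i:=e_i\cap e_{i+1}$ for $i\in\{1,\dots,\ell\}$, we have $(s_i\cup s_j\cup s_k)\setminus e\neq\emptyset$ for all $1\le i<j<k\le\ell$ and all $e\in E$. *)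

(* Defs.v *)
From mathcomp Require Import all_boot.

Set Implicit Arguments.
Unset Strict Implicit.
Unset Printing Implicit Defensive.

Record hypergraph (V : finType) := Hypergraph {
  edges : {set {set V}};
  edges_card : forall e : {set V}, e \in edges -> 2 <= #|e|
}.

(* f_1, ..., f_m is the sequence f, so f_i is nth set0 f i.-1; below, indices
   are 0-based and the default value set0 is never reached. *)
Definition running_intersection_order (V : finType) (f : seq {set V}) : Prop :=
  forall k : nat, 0 < k < size f ->
    exists2 j : nat, j < k &
      nth set0 f k :&: (\bigcup_(i < k) nth set0 f i) \subset nth set0 f j.

Definition alpha_acyclic (V : finType) (G : hypergraph V) : Prop :=
  exists f : seq {set V},
    [/\ uniq f, f =i edges G & running_intersection_order f].

(* s_(i+1) in 1-based numbering. *)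
Definition cycle_sep (V : finType) (C : seq {set V}) (i : nat) : {set V} :=
  nth set0 C i :&: nth set0 C i.+1.

(* C lists e_1, ..., e_l, e_(l+1), so it has l + 1 items and the first one is
   repeated at the end.  Distinctness of e_1, ..., e_l is not part of the
   definition. *)
Definition simple_cycle (V : finType) (G : hypergraph V) (l : nat)
    (C : seq {set V}) : Prop :=
  [/\ 3 <= l,
      size C = l.+1,
      {subset C <= edges G},
      nth set0 C l = nth set0 C 0
    & forall i j k : nat, i < j -> j < k -> k < l ->
      forall e : {set V}, e \in edges G ->
      (cycle_sep C i :|: cycle_sep C j :|: cycle_sep C k) :\: e != set0].

(* Main.v *)
(** If the last edge g of a running intersection order meets the union of the
    others inside h, replacing g by h turns a simple cycle into one that avoids g,
    so removing last edges one by one leaves no room for a simple cycle.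

    Conversely, without simple cycles the adjacency graph of the hypergraph is
    conformal (every clique lies in an edge) and chordal, hence has a simplicial
    vertex v.  If some edge is contained in another one, remove it and put it last
    in the order; otherwise v lies in exactly one edge, and deleting v from it
    changes neither the absence of simple cycles nor the running intersection
    property of an order. *)

Require Import Defs.
From mathcomp Require Import all_boot.
From mathcomp Require Import zify.

Section SimpleCycles.

Variable V : finType.
Implicit Types (E : {set {set V}}) (C f : seq {set V}) (A W K : {set V}).

(** * Simple cycles and their transfer between families of edges *)

(** Stated for an arbitrary family [E], because deleting a node may leave edges with fewer than two
    nodes. *)
Definition cycle_in E l C : Prop :=
  [/\ 3 <= l,
      size C = l.+1,
      {subset C <= E},
      nth set0 C l = nth set0 C 0
    & forall i j k : nat, i < j -> j < k -> k < l ->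
      forall e : {set V}, e \in E ->
      (cycle_sep C i :|: cycle_sep C j :|: cycle_sep C k) :\: e != set0].

(** Otherwise the repeated edge would contain three cyclically consecutive separators. *)
Lemma cycle_in_consecutive_neq E l C i :
  cycle_in E l C -> i < l -> nth set0 C i != nth set0 C i.+1.
Proof.
case=> l3 sC CE Cl Csep il; apply/eqP=> eqi.
have noj a b c : a < b -> b < c -> c < l ->
    cycle_sep C a \subset nth set0 C i -> cycle_sep C b \subset nth set0 C i ->
    cycle_sep C c \subset nth set0 C i -> False.
  move=> ab bc cl sa sb sc.
  have eE : nth set0 C i \in E by apply: CE; rewrite mem_nth // sC; lia.
  move/eqP: (Csep a b c ab bc cl _ eE); apply; apply/eqP.
  by rewrite setD_eq0 !subUset sa sb sc.
have sL j : j = i \/ j = i.+1 -> cycle_sep C j \subset nth set0 C i.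
  by case=> ->; [|rewrite eqi]; exact: subsetIl.
have sR j : j.+1 = i \/ j = i -> cycle_sep C j \subset nth set0 C i.
  by case=> [<-|->]; rewrite /cycle_sep ?subsetIl ?subsetIr.
(* The ends wrap around: [l.-1] precedes [0], and [0] follows [l.-1]. *)
case: (posnP i) => [i0 | i_gt0].
  apply: (noj 0 1 l.-1); try lia; try by apply: sL; lia.
  by rewrite /cycle_sep prednK ?Cl ?i0 ?subsetIr //; lia.
have [il1 | il1] := ltnP i.+1 l.
  by apply: (noj i.-1 i i.+1); try lia; [apply: sR; lia | apply: sL; lia..].
apply: (noj 0 i.-1 i); try lia; try by apply: sR; lia.
have -> : nth set0 C i = nth set0 C 0 by rewrite eqi -Cl; congr nth; lia.
exact: subsetIl.
Qed.

(** Consecutive edges differ, so the new separators contain the old ones. An edge of [E'] containing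
    three new separators would thus yield an edge of [E] containing three old ones. *)
Lemma cycle_in_transfer E E' (phi : {set V} -> {set V}) l C :
  {in E, forall e, phi e \in E'} ->
  {in E &, forall e1 e2, e1 != e2 -> e1 :&: e2 \subset phi e1 :&: phi e2} ->
  {in E', forall e', exists2 e, e \in E & e' :&: cover E \subset e} ->
  cycle_in E l C -> cycle_in E' l (map phi C).
Proof.
move=> phiE phiI E'E cC; have neqC := cycle_in_consecutive_neq _ _ _ _ cC.
case: cC => l3 sC CE Cl Csep.
have nthCE i : i <= l -> nth set0 C i \in E by move=> ?; apply: CE; rewrite mem_nth ?sC.
split=> //; first by rewrite size_map.
- by move=> _ /mapP[e /CE eE ->]; apply: phiE.
- by rewrite !(nth_map set0) ?sC ?Cl.
move=> i j k ij jk kl e' /E'E[e eE e'e].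
have /set0Pn[x] := Csep i j k ij jk kl _ eE; rewrite in_setD !in_setU => /andP[xe xs].
have sep a : a < l -> x \in cycle_sep C a ->
    x \in cycle_sep (map phi C) a /\ x \in cover E.
  move=> al xa; rewrite /cycle_sep !(nth_map set0) ?sC //; try lia.
  split.
    by apply: (subsetP (phiI _ _ _ _ (neqC _ al))) xa; apply: nthCE; lia.
  by apply/bigcupP; exists (nth set0 C a); [apply: nthCE; lia | case/setIP: xa].
apply/set0Pn; exists x; rewrite !in_setD !in_setU.
have nxe' : x \in cover E -> x \notin e'.
  by move=> xE; apply: contra xe => xe'; apply: (subsetP e'e); rewrite inE xe'.
by case/orP: xs => [/orP[]|] /sep[|-> /nxe' ->]; rewrite ?orbT //; lia.
Qed.

(** * Running intersection orders exclude simple cycles *)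

Lemma running_intersection_order_rcons f (g : {set V}) :
  running_intersection_order (rcons f g) <->
  running_intersection_order f /\
  (f = [::] \/ exists2 h, h \in f & g :&: \bigcup_(e in f) e \subset h).
Proof.
have bigE k : k <= size f ->
    \bigcup_(i < k) nth set0 (rcons f g) i = \bigcup_(i < k) nth set0 f i.
  move=> kf; apply: eq_bigr => i _; rewrite nth_rcons.
  by have -> : i < size f by have := ltn_ord i; lia.
have bigf : \bigcup_(i < size f) nth set0 f i = \bigcup_(e in f) e.
  apply/setP=> x; apply/bigcupP/bigcupP => [[i _ xi]|[e ef xe]].
    by exists (nth set0 f i) => //; rewrite mem_nth.
  rewrite -index_mem in ef; exists (Ordinal ef) => //=.
  by rewrite nth_index // -index_mem.
split=> [H | [H1 H2] k].
  split=> [k /andP[k0 kf]|].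
    have [|j jk] := H k; first by rewrite size_rcons; lia.
    rewrite bigE ?nth_rcons ?kf; last by lia.
    by have -> : j < size f; [lia | exists j].
  case: f => [|e f] in bigE bigf H *; [by left | right].
  have [|j jk] := H (size (e :: f)); first by rewrite size_rcons /=; lia.
  rewrite bigE // bigf !nth_rcons ltnn eqxx jk => sub.
  by exists (nth set0 (e :: f) j) => //; rewrite mem_nth.
rewrite size_rcons ltnS => /andP[k0]; rewrite leq_eqVlt => /predU1P[kE|kf].
  case: H2 => [f0|[h hf sub]]; first by move: k0; rewrite kE f0.
  exists (index h f); first by rewrite kE index_mem.
  rewrite bigE ?kE // bigf !nth_rcons ltnn eqxx.
  by rewrite index_mem hf nth_index.
have [|j jk sub] := H1 k; first by rewrite k0.
exists j => //; rewrite bigE ?nth_rcons ?kf; last by lia.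
by have -> : j < size f by lia.
Qed.

Lemma running_intersection_order_acyclic f l C :
  running_intersection_order f -> ~ cycle_in [set e in f] l C.
Proof.
elim/last_ind: f C => [|f g IH] C.
  move=> _ [l3 sC CE _ _]; have := CE (nth set0 C 0).
  by rewrite mem_nth ?sC // !inE => /(_ isT).
case/running_intersection_order_rcons=> fO [f0|[h hf sub]] cC.
  have := cycle_in_consecutive_neq _ _ _ 0 cC.
  case: (cC) => l3 sC CE _ _.
  have eqg i : i <= l -> nth set0 C i = g.
    move=> il; have /CE : nth set0 C i \in C by rewrite mem_nth ?sC.
    by rewrite f0 !inE => /eqP.
  by rewrite !eqg ?eqxx //; lia.
have fE (e : {set V}) : e \in [set e in rcons f g] -> e != g -> e \in f.
  by rewrite inE mem_rcons inE => /predU1P[->|//]; rewrite eqxx.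
have sub1 (e : {set V}) : e \in f -> g :&: e \subset h.
  by move=> ef; apply: subset_trans sub; apply/setIS/(bigcup_sup e).
(* Since [g] meets every other edge inside [h], this replacement can only enlarge intersections of
   distinct edges. *)
apply: (IH (map (fun e => if e == g then h else e) C)) => //.
apply: cycle_in_transfer cC => [e eE|e1 e2 e1E e2E ne|e ef].
- by rewrite inE; case: eqVneq => // /(fE _ eE).
- case: (eqVneq e1 g) ne => [-> ne|ne1 _].
    rewrite eq_sym (negbTE ne) subsetI subsetIr andbT sub1 //.
    by apply: fE; rewrite // eq_sym.
  case: (eqVneq e2 g) => [->|//].
  by rewrite subsetI subsetIl setIC sub1 // fE.
by exists e; rewrite ?subsetIl // inE mem_rcons inE; rewrite inE in ef; rewrite ef orbT.
Qed.

(** * The adjacency graph and its conformality *)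

Definition adj E : rel V :=
  fun x y => [exists e in E, (x \in e) && (y \in e)].

Lemma adjP E x y :
  reflect (exists2 e, e \in E & x \in e /\ y \in e) (adj E x y).
Proof.
apply: (iffP exists_inP) => [[e eE /andP[]]|[e eE [xe ye]]]; exists e => //.
by rewrite xe.
Qed.

Lemma adj_sym E : symmetric (adj E).
Proof. by move=> x y; apply/adjP/adjP=> [] [e eE []]; exists e. Qed.

Lemma adj_cover E x : x \in cover E -> adj E x x.
Proof. by case/bigcupP=> e eE xe; apply/adjP; exists e. Qed.

(** The case [x = y] is included, so a clique of [adj E] consists of covered nodes. *)
Definition is_clique (e : rel V) K := {in K &, forall x y, e x y}.

(* In a minimal clique K contained in no edge, the edges covering K :\ a,
   K :\ b and K :\ c form a simple cycle of length three. *)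
Lemma acyclic_conformal E K :
  (forall l C, ~ cycle_in E l C) -> is_clique (adj E) K -> K != set0 ->
  exists2 e, e \in E & K \subset e.
Proof.
move=> noC; have [n] := ubnP #|K|.
elim: n K => // n IH K leKn clK K0.
apply/exists_inP; apply: contraT => /exists_inPn noE.
have [a aK] := set0Pn _ K0.
(* A clique with one or two nodes lies in an edge, so [K] has three distinct nodes. *)
have [b bK nba] : exists2 b, b \in K & b != a.
  apply/exists_inP; apply: contraT => /exists_inPn Ka.
  have /adjP[e eE [ae _]] := clK _ _ aK aK.
  case/negP: (noE _ eE); apply/subsetP=> x /Ka; rewrite negbK => /eqP-> //.
have [c cK /andP[nca ncb]] : exists2 c, c \in K & (c != a) && (c != b).
  apply/exists_inP; apply: contraT => /exists_inPn Ka.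
  have /adjP[e eE [ae be]] := clK _ _ aK bK.
  case/negP: (noE _ eE); apply/subsetP=> x /Ka.
  by rewrite negb_and !negbK => /orP[]/eqP->.
have del x y : x \in K -> y \in K -> y != x ->
    exists2 e, e \in E & K :\ x \subset e.
  move=> xK yK nyx; apply: IH.
  - by move: leKn; rewrite (cardsD1 x K) xK; lia.
  - by move=> u v /setD1P[_ uK] /setD1P[_ vK]; apply: clK.
  - by apply/set0Pn; exists y; rewrite in_setD1 nyx.
have [ea eaE Kea] := del a b aK bK nba.
have [eb ebE Keb] := del b c bK cK ncb.
have [ec ecE Kec] := del c a cK aK (negbT (etrans (eq_sym _ _) (negbTE nca))).
exfalso; apply: (noC 3 [:: ea; eb; ec; ea]); split=> //.
  by move=> e; rewrite !inE => /or4P[] /eqP->.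
case=> [|i] [|[|j]] [|[|[|k]]] // _ _ _ e eE.
(* Each node of [K] differs from two of [a], [b], [c], so it lies in two of the three edges and
   hence in a separator. *)
rewrite setD_eq0; apply: contra (noE e eE) => /subsetP sub.
apply/subsetP=> x xK; apply: sub; rewrite /cycle_sep /= !inE.
have ina : x != a -> x \in ea by move=> ?; apply: (subsetP Kea); rewrite !inE xK andbT.
have inb : x != b -> x \in eb by move=> ?; apply: (subsetP Keb); rewrite !inE xK andbT.
have inc : x != c -> x \in ec by move=> ?; apply: (subsetP Kec); rewrite !inE xK andbT.
have [xa|/ina->] := eqVneq x a.
  by rewrite inb ?inc ?orbT // xa eq_sym.
have [xb|/inb->] := eqVneq x b; last by [].
by rewrite inc ?orbT // xb eq_sym.
Qed.

(** * Chordless paths, holes and simplicial vertices *)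

(** Induced paths, for symmetric [e]; where [e] is reflexive, nonconsecutive entries are
    automatically distinct. *)
Fixpoint chordless (e : rel V) (s : seq V) : bool :=
  if s is x :: s' then
    (if s' is y :: s'' then [&& x != y, e x y & ~~ has (e x) s''] else true)
    && chordless e s'
  else true.

Lemma chordless_nth (e : rel V) s x0 i j :
  chordless e s -> i < j -> j < size s -> e (nth x0 s i) (nth x0 s j) ->
  j = i.+1 /\ nth x0 s i != nth x0 s j.
Proof.
elim: s i j => [|x s IH] [|i] [|j] //=; last first.
  by case/andP=> _ cs ij js /(IH i j cs ij js)[->].
case: s IH => [|y s] IH //= /andP[/and3P[nxy exy nh] _] _ js.
case: j js => [|j] //= js eij; case/hasP: nh; exists (nth x0 s j) => //.
by rewrite mem_nth.
Qed.

Lemma chordless_edge (e : rel V) s x0 i :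
  chordless e s -> i.+1 < size s -> e (nth x0 s i) (nth x0 s i.+1).
Proof.
elim: s i => [|x [|y s] IH] [|i] //= /andP[/and3P[_ exy _] cs] // ilt.
exact: IH.
Qed.

Lemma chordless_path (e : rel V) x p : path e x p ->
  exists q, [/\ chordless e (x :: q), last x q = last x p & {subset q <= p}].
Proof.
(* To prepend [y], keep [s] only from its last entry adjacent to [y] onwards; if that entry is [y]
   itself, it becomes the head. *)
have ext y s : chordless e s -> has (e y) s ->
    exists t, [/\ chordless e (y :: t), last y t = last y s & {subset t <= s}].
  elim: s => // z s IH cs; have cs' : chordless e s by case/andP: cs.
  have subz t : {subset t <= s} -> {subset t <= z :: s}.
    by move=> ts u /ts; rewrite inE orbC => ->.
  case: (boolP (has (e y) s)) => [hs _|nhs].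
    have [t [ct lt ts]] := IH cs' hs; exists t; split=> //; last exact: subz.
    by rewrite lt; case: (s) hs.
  rewrite /= (negbTE nhs) orbF => eyz.
  have [->|nyz] := eqVneq y z; first by exists s; split=> //; apply: subz.
  by exists (z :: s); split=> //; apply/andP; split=> //; rewrite nyz eyz.
elim: p x => [|y p IH] x /=; first by exists [::].
case/andP=> exy /IH[q [cq lq qp]].
have [|t [ct lt tq]] := ext x (y :: q) cq; first by rewrite /= exy.
exists t; split=> //; first by rewrite lt.
by move=> z /tq; rewrite !inE => /predU1P[->|/qp->]; rewrite ?eqxx ?orbT.
Qed.

(** Chordality: [r] would close the path [x :: p] to an induced cycle of length at least four. *)
Definition hole_free (e : rel V) := forall r x p,
  chordless e (x :: p) -> 1 < size p -> e r x -> e r (last x p) ->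
  ~ {in x :: p, forall z, e r z -> z = x \/ z = last x p}.

(** Edges chosen around the sides of a hole form a simple cycle: each separator contains a node of
    the hole, and among three nodes of a hole two are nonadjacent. *)
Lemma acyclic_hole_free E : (forall l C, ~ cycle_in E l C) -> hole_free (adj E).
Proof.
move=> noC r x p chp p2 rx rl rp.
set m := size p in p2; set q := x :: p in chp rp.
have lastE : last x p = nth r q m by rewrite /m (last_nth r).
(* The hole is prolonged by one step so that the i-th separator contains
   g i.+1 also where the cycle closes up. *)
pose g := nth r (r :: rcons (rcons q r) x).
have sq : size q = m.+1 by [].
have gE i : g i.+1 = nth r (rcons (rcons q r) x) i by [].
have gS i : i <= m -> g i.+1 = nth r q i.
  by move=> im; rewrite gE !nth_rcons size_rcons sq !ltnS im (leqW im).
have gr : g m.+2 = r.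
  by rewrite gE !nth_rcons size_rcons sq ltnSn ltnn eqxx.
have gx : g m.+3 = x.
  by rewrite gE nth_rcons size_rcons sq ltnn eqxx.
have gadj i : i <= m.+2 -> adj E (g i) (g i.+1).
  rewrite leq_eqVlt => /predU1P[->|]; first by rewrite gr gx.
  rewrite ltnS leq_eqVlt => /predU1P[->|].
    by rewrite gr gS // -lastE adj_sym.
  case: i => [|i] im; first by rewrite gS.
  by rewrite !gS; try lia; apply: chordless_edge.
pose pe u v := odflt set0 [pick e in E | (u \in e) && (v \in e)].
have peP u v : adj E u v -> [/\ pe u v \in E, u \in pe u v & v \in pe u v].
  rewrite /pe; case: pickP => [e /and3P[]|no] //= /adjP[e eE [ue ve]].
  by have := no e; rewrite eE ue ve.
pose C := mkseq (fun i => pe (g i) (g i.+1)) m.+3.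
have nC i : i < m.+3 -> nth set0 C i = pe (g i) (g i.+1) by exact: nth_mkseq.
apply: (noC m.+2 C); split; [lia | exact: size_mkseq | | |].
- by move=> e /mapP[i + ->]; rewrite mem_iota => /andP[_ im]; case: (peP _ _ (gadj i im)).
- by rewrite !nC // gr gx gS.
move=> i j k ij jk km e eE; rewrite setD_eq0; apply/negP => /subsetP sub.
have gsep a : a < m.+2 -> g a.+1 \in cycle_sep C a.
  move=> am; rewrite inE !nC; try lia.
  have [_ _ ->] := peP _ _ (gadj a (ltnW am)).
  by have [_ ->] := peP _ _ (gadj a.+1 am).
have gie : g i.+1 \in e by apply: sub; rewrite !in_setU gsep //; lia.
have gje : g j.+1 \in e by apply: sub; rewrite !in_setU gsep ?orbT //; lia.
have gke : g k.+1 \in e by apply: sub; rewrite !in_setU gsep ?orbT //; lia.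
(* If [k <= m], all three nodes lie on the path, and the first and third are not consecutive
   there. *)
have [km'|km'] := leqP k m.
  rewrite !gS in gie gke; try lia.
  have [|||kE _] := chordless_nth _ _ r i k chp; rewrite /= -/m; try lia.
  by apply/adjP; exists e.
(* Otherwise the third node is [r], so the other two are the nonadjacent ends of the path. *)
have kE : k = m.+1 by lia.
rewrite kE gr in gke; rewrite !gS in gie gje; try lia.
have [||_ nij] := chordless_nth _ _ r i j chp ij; rewrite /= -/m; try lia.
  by apply/adjP; exists e.
have ends a : a <= m -> nth r q a \in e -> nth r q a = x \/ nth r q a = last x p.
  move=> am ae; apply: rp; first by rewrite mem_nth.
  by apply/adjP; exists e.
have xl : adj E (nth r q 0) (nth r q m).
  rewrite -lastE; apply/adjP; exists e => //=.
  have [|iE|iE] := ends i _ gie; first by lia.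
    have [|jE|jE] := ends j _ gje; first by lia.
      by rewrite iE jE eqxx in nij.
    by rewrite -jE -{1}iE.
  have [|jE|jE] := ends j _ gje; first by lia.
    by rewrite -iE -{1}jE.
  by rewrite iE jE eqxx in nij.
have [||mE _] := chordless_nth _ _ r 0 m chp _ _ xl; rewrite /= -/m; lia.
Qed.

(* Take a connected A, maximal among those having a vertex of W not adjacent to
   it, and let R be the set of these vertices.  By maximality every neighbour of A
   outside A is adjacent to all of R, and two such neighbours are adjacent, as
   otherwise a chordless path between them through A closes up to a hole with any
   vertex of R.  So a simplicial vertex of R is simplicial in W. *)
Lemma hole_free_simplicial (e : rel V) W :
  symmetric e -> hole_free e -> {in W, reflexive e} -> W != set0 ->
  exists2 v, v \in W & is_clique e [set x in W | e v x].
Proof.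
move=> esym hf; have [n] := ubnP #|W|.
elim: n W => // n IH W leWn refl W0.
case: (boolP [forall a in W, forall b in W, e a b]) => [/forall_inP clW|].
  have [v vW] := set0Pn _ W0; exists v => // x y; rewrite !inE.
  by move=> /andP[xW _] /andP[yW _]; move/forall_inP: (clW _ xW); apply.
case/forall_inPn=> a aW /forall_inPn[b bW nab].
pose rA A := [rel u v | [&& u \in A, v \in A & e u v]].
have rA_sym A : connect_sym (rA A).
  by apply: sym_connect_sym => u v /=; rewrite esym andbCA.
pose Q A := [&& A \subset W,
  [forall u in A, forall v in A, connect (rA A) u v] &
  [exists r in W, [forall z in A, ~~ e z r]]].
have Qa : Q [set a].
  apply/and3P; split; first by rewrite sub1set.
    by apply/forall_inP=> u /set1P->; apply/forall_inP=> v /set1P->.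
  by apply/exists_inP; exists b => //; apply/forall_inP=> z /set1P->.
case: (arg_maxnP (fun A => #|A|) Qa) => A QA maxA.
case/and3P: QA => /subsetP AW /forall_inP conA exr.
have conA' u v : u \in A -> v \in A -> connect (rA A) u v.
  by move=> uA vA; move/forall_inP: (conA u uA); apply.
pose R := [set r in W | [forall z in A, ~~ e z r]].
have RP r z : r \in R -> z \in A -> ~~ e z r.
  by rewrite inE => /andP[_ /forall_inP]; apply.
have RW r : r \in R -> r \in W by rewrite inE => /andP[].
have R0 : R != set0.
  by case/exists_inP: exr => r rW rA0; apply/set0Pn; exists r; rewrite inE rW.
have [a0 a0A] : exists a0, a0 \in A.
  apply/set0Pn; rewrite -card_gt0.
  by have := maxA _ Qa; rewrite cards1.
have [||v vR clR] := IH R _ _ R0.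
- suff : #|R| < #|W| by lia.
  apply: proper_card; apply/properP; split; first by apply/subsetP=> r /RW.
  exists a0; first exact: AW.
  by apply/negP=> /RP/(_ a0A); rewrite refl ?AW.
- by move=> r /RW; apply: refl.
exists v; first exact: RW.
have outR x : x \in W -> e v x -> x \notin R ->
    [/\ x \notin A, exists2 z, z \in A & e x z & {in R, forall r, e x r}].
  move=> xW evx xR.
  have xA : x \notin A by apply/negP=> /(RP _ _ vR); rewrite esym evx.
  have exz : exists2 z, z \in A & e x z.
    move: xR; rewrite inE xW /= => /forall_inPn[z zA]; rewrite negbK => ezx.
    by exists z; rewrite // esym.
  split=> // r rR; apply/negPn/negP=> nxr.
  (* The larger set is still connected and [r] is adjacent to none of its nodes. *)
  suff /maxA : Q (x |: A) by rewrite /= cardsU1 xA add1n ltnn.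
  have [z zA xz] := exz.
  have subA : subrel (connect (rA A)) (connect (rA (x |: A))).
    apply: connect_sub => u w /and3P[uA wA uw]; apply: connect1.
    by rewrite /= !in_setU uA wA uw !orbT.
  have xcon u : u \in A -> connect (rA (x |: A)) x u.
    move=> uA; apply: connect_trans (subA _ _ (conA' _ _ zA uA)).
    by apply: connect1; rewrite /= !inE eqxx zA xz orbT.
  apply/and3P; split.
  - by apply/subsetP=> u /setU1P[->|/AW].
  - apply/forall_inP=> u /setU1P uA; apply/forall_inP=> w /setU1P wA.
    case: uA wA => [->|uA] [->|wA]; rewrite ?connect0 //; first exact: xcon.
      by rewrite rA_sym xcon.
    exact/subA/conA'.
  - apply/exists_inP; exists r; first exact: RW.
    by apply/forall_inP=> u /setU1P[->|/(RP _ _ rR)].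
move=> x y; rewrite !inE => /andP[xW vx] /andP[yW vy].
case: (boolP (x \in R)) => xR; case: (boolP (y \in R)) => yR.
- by apply: clR; rewrite inE ?xR ?yR.
- by have [_ _ yall] := outR _ yW vy yR; rewrite esym yall.
- by have [_ _ xall] := outR _ xW vx xR; rewrite xall.
have [xA [x' x'A xx'] _] := outR _ xW vx xR.
have [yA [y' y'A yy'] _] := outR _ yW vy yR.
apply/negPn/negP=> nxy.
have /connectP[p pA y'E] := conA' _ _ x'A y'A.
have inA z : z \in x' :: p -> z \in A.
  elim: p (x') x'A pA {y'E} => [|w p IHp] u uA /=; first by rewrite inE => _ /eqP->.
  by case/andP=> /and3P[_ wA _] /(IHp _ wA) {}IHp; rewrite inE => /predU1P[->|/IHp].
have pathp : path e x (rcons (x' :: p) y).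
  rewrite rcons_path /= xx' -y'E esym yy' andbT.
  by apply: sub_path pA => u w /and3P[].
have [q [chq lq qsub]] := chordless_path _ _ _ pathp.
rewrite last_rcons in lq.
(* The hole is closed by [v], which has no neighbour in [A] because it lies in [R]. *)
apply: (hf v x q) => //.
- case: q chq lq {qsub} => [_ /= xy|z [|//] ch /= zy].
    by rewrite -xy refl in nxy.
  by case/and3P: ch => /and3P[_]; rewrite zy (negbTE nxy).
- by rewrite lq.
move=> z; rewrite inE => /predU1P[->|/qsub]; first by left.
rewrite mem_rcons inE => /predU1P[->|/inA zA]; first by rewrite lq; right.
by rewrite esym (negbTE (RP _ _ vR zA)).
Qed.

(** * Construction of a running intersection order *)

(** A node of at most one edge lies in no intersection of an edge with the earlier ones, so it can
    be put back. *)
Lemma running_intersection_order_setD1 f (e0 : {set V}) v :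
  uniq f -> {in f, forall e : {set V}, v \in e -> e = e0} ->
  running_intersection_order [seq e :\ v | e <- f] ->
  running_intersection_order f.
Proof.
elim/last_ind: f => // f g IH; rewrite rcons_uniq => /andP[gf uf] ve0.
have ve0f : {in f, forall e : {set V}, v \in e -> e = e0}.
  by move=> e ef; apply: ve0; rewrite mem_rcons inE ef orbT.
rewrite map_rcons => /running_intersection_order_rcons[/(IH uf ve0f) fO H].
apply/running_intersection_order_rcons; split=> //.
case: H => [|[_ /mapP[h hf ->] sub]]; first by case: (f); [left|].
right; exists h => //; apply/subsetP=> x /setIP[xg /bigcupP[e ef xe]].
have [xv|nxv] := eqVneq x v.
  have gE : g = e0 by apply: ve0; rewrite -?xv // mem_rcons mem_head.
  by rewrite gE -(ve0f e) ?ef -?xv in gf.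
have /(subsetP sub) : x \in (g :\ v) :&: \bigcup_(e in [seq e :\ v | e <- f]) e.
  rewrite !inE nxv xg /=; apply/bigcupP; exists (e :\ v); first exact: map_f.
  by rewrite !inE nxv.
by rewrite !inE nxv.
Qed.

Lemma acyclic_running_intersection_order E :
  (forall l C, ~ cycle_in E l C) ->
  exists f, [/\ uniq f, f =i E & running_intersection_order f].
Proof.
(* One case removes an edge, the other a covered node; neither increases the other summand. *)
have [n] := ubnP (#|cover E| + #|E|).
elim: n E => // n IH E leEn noC.
case: (boolP [exists e in E, exists e' in E, e \proper e']) => [|/exists_inPn anti].
  case/exists_inP=> e eE /exists_inP[e' e'E ee'].
  have e'D : e' \in E :\ e.
    by rewrite !inE e'E andbT; apply: contraTneq ee' => ->; rewrite properxx.
  have sDE : E :\ e \subset E by exact: subD1set.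
  have [||f [uf fE fO]] := IH (E :\ e).
  - suff : #|cover (E :\ e)| <= #|cover E|.
      by move: leEn; rewrite (cardsD1 e E) eE; lia.
    by apply/subset_leq_card/bigcupsP=> x xE; apply/bigcup_sup/(subsetP sDE).
  - move=> l C cC; apply: (noC l (map id C)).
    apply: cycle_in_transfer cC => [x /(subsetP sDE)|//|x xE] //.
    have [->|nxe] := eqVneq x e.
      by exists e'; rewrite // subIset // proper_sub.
    by exists x; rewrite ?subsetIl // !inE nxe.
  exists (rcons f e); split.
  - by rewrite rcons_uniq uf fE !inE eqxx.
  - by move=> x; rewrite mem_rcons inE fE !inE; case: eqVneq => [->|].
  apply/running_intersection_order_rcons; split=> //; right.
  by exists e'; rewrite ?fE // subIset // proper_sub.
have {}anti (e e' : {set V}) : e \in E -> e' \in E -> e \subset e' -> e = e'.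
  move=> eE e'E see'; apply/eqP; apply: contraNT (anti e eE) => ne.
  by apply/exists_inP; exists e'; rewrite // properEneq ne.
(* With no covered node, [E] has at most the edge [set0]. *)
have [cov0|cov0] := eqVneq (cover E) set0.
  have E0 (e : {set V}) : e \in E -> e = set0.
    move=> eE; apply/eqP; rewrite -subset0 -cov0; exact: bigcup_sup.
  have [->|[e eE]] := set_0Vmem E.
    by exists [::]; split=> // [x|[|k]//]; rewrite inE.
  exists [:: e]; split=> // [x|[|k]//]; rewrite inE.
  by apply/eqP/idP=> [->//|xE]; rewrite (E0 e) // (E0 x).
have [v vE clv] := hole_free_simplicial _ _ (adj_sym E) (acyclic_hole_free _ noC)
  (fun x => @adj_cover E x) cov0.
have vK : v \in [set x in cover E | adj E v x] by rewrite inE vE adj_cover.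
have [|e0 e0E Ke0] := acyclic_conformal _ _ noC clv; first by apply/set0Pn; exists v.
(* An edge through [v] lies in the neighbourhood of [v], hence in [e0], and no edge is properly
   contained in another. *)
have only (e : {set V}) : e \in E -> v \in e -> e = e0.
  move=> eE ve; apply: anti => //; apply: subset_trans Ke0; apply/subsetP=> x xe.
  by rewrite inE; apply/andP; split; [apply/bigcupP | apply/adjP]; exists e.
pose E1 := [set e :\ v | e in E].
(* On [E1] this inverts the deletion of [v]; an edge avoiding [v] and equal to [e0 :\ v] would be
   properly contained in [e0]. *)
pose phi d := if d == e0 :\ v then e0 else d.
have ve0 : v \in e0 by apply: (subsetP Ke0).
have phiK (e : {set V}) : e \in E -> phi (e :\ v) = e.
  move=> eE; rewrite /phi; case: (boolP (v \in e)) => [/(only _ eE)->|nve].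
    by rewrite eqxx.
  rewrite setDE (setIidPl _) ?sub1set ?inE //; last first.
    by apply/subsetP=> x xe; rewrite !inE; apply: contraNneq nve => <-.
  case: eqVneq => // ee0; apply/esym/anti => //.
  by rewrite ee0 subD1set.
have [||f1 [uf1 f1E f1O]] := IH E1.
- have le1 : #|E1| <= #|E| by exact: leq_imset_card.
  suff lt1 : #|cover E1| < #|cover E|.
    rewrite -ltnS; apply: leq_trans leEn; rewrite ltnS.
    by rewrite -addSn leq_add.
  rewrite (cardsD1 v (cover E)) vE add1n ltnS; apply/subset_leq_card/bigcupsP.
  move=> _ /imsetP[e eE ->]; apply: setSD; exact: bigcup_sup.
- move=> l C cC; apply: (noC l (map phi C)).
  have phi1 : {in E1, forall d : {set V}, phi d \in E /\ d \subset phi d}.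
    by move=> _ /imsetP[e eE ->]; rewrite phiK // subD1set.
  apply: cycle_in_transfer cC => [d /phi1[]//|d d' /phi1[_ sd] /phi1[_ sd'] _|e eE].
    exact: setISS.
  exists (e :\ v); first exact: imset_f.
  apply/subsetP=> x /setIP[xe /bigcupP[_ /imsetP[e' _ ->]]].
  by rewrite !inE xe => /andP[->].
have f1K : [seq e :\ v | e <- map phi f1] = f1.
  rewrite -map_comp -[RHS]map_id; apply/eq_in_map=> d.
  by rewrite f1E => /imsetP[e eE ->] /=; rewrite phiK.
have fE : map phi f1 =i E.
  move=> x; apply/mapP/idP=> [[d]|xE].
    by rewrite f1E => /imsetP[e eE ->] ->; rewrite phiK.
  by exists (x :\ v); rewrite ?phiK // f1E; apply: imset_f.
have uf : uniq (map phi f1) by apply: (@map_uniq _ _ (fun e => e :\ v)); rewrite f1K.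
exists (map phi f1); split=> //.
apply: (running_intersection_order_setD1 _ e0 v) => //; last by rewrite f1K.
by move=> e; rewrite fE => /only.
Qed.

End SimpleCycles.

Theorem theorem3 (V : finType) (G : hypergraph V) :
  alpha_acyclic G <->
  ~ (exists (l : nat) (C : seq {set V}), simple_cycle G l C).
Proof.
split=> [[f [_ fE fO]] [l [C cC]]|noC].
  have edgesE : edges G = [set e in f] by apply/setP=> e; rewrite inE fE.
  apply: (running_intersection_order_acyclic _ f l C fO).
  by rewrite -edgesE.
apply: acyclic_running_intersection_order => l C cC.
by apply: noC; exists l, C.
Qed.
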